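(* For all $n \geq 0$ and $k \geq 1$, $s_n(132, 12\cdots k) = a_{2n+1}(132, 12\cdots (k+1))$. As a result, for all $n \ge 0$ and $k \ge 1$, a permutation $w \in S_n(132)$ has longest increasing subsequence of length $k$ if and only if $\varphi(w) \in A_{2n+1}(132)$ has longest increasing subsequence of length $k+1$.
   Context: A permutation $w = w_1w_2\cdots w_n$ of length $n$ is a sequence containing each of the integers $1,\dots,n$ exactly once (for $n=0$ there is exactly one, the empty permutation). It is alternating if $w_1 < w_2 > w_3 < w_4 > \cdots$. A sequence $w = w_1\cdots w_n$ of distinct integers contains a permutation $p$ of length $m$ (a pattern) if there are indices $1 \le i_1 < \cdots < i_m \le n$ such that $w_{i_1}\cdots w_{i_m}$ is order-isomorphic to $p$ (same relative order of entries); otherwise $w$ avoids $p$. $S_n(r_1,\dots,r_m)$ is the set of permutations of length $n$ avoiding all of $r_1,\dots,r_m$, and $A_n(r_1,\dots,r_m)$ is the set of alternating permutations of length $n$ avoiding all of $r_1,\dots,r_m$; $s_n(r_1,\dots,r_m) = |S_n(r_1,\dots,r_m)|$ and $a_n(r_1,\dots,r_m) = |A_n(r_1,\dots,r_m)|$. The pattern $12\cdots k$ is the increasing permutation of length $k$. Binary trees: each vertex has an optional left child and an optional right child, with left and right distinguished. For a finite sequence $w = w_1\cdots w_n$ of distinct integers, the labeled decreasing binary tree $T(w)$ is defined recursively: if $w$ is empty, $T(w)$ is empty; otherwise, if $w_k$ is the maximal entry, the root is labeled $w_k$, its left subtree is $T(w_1\cdots w_{k-1})$ and its right subtree is $T(w_{k+1}\cdots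 w_n)$. This is a bijection between permutations of length $n$ and decreasing binary trees labeled by $\{1,\dots,n\}$. If $w$ avoids $132$, then at each vertex $v$ of $T(w)$ every label in the left subtree at $v$ is larger than every label in the right subtree at $v$; each unlabeled binary tree with $m$ vertices has exactly one decreasing labeling by $\{1,\dots,m\}$ with this property, and it is called the labeled tree associated to the unlabeled tree. The completion $C(T)$ of an unlabeled binary tree $T$ is obtained by adding vertices to $T$ so that every vertex of $T$ has two children in $C(T)$ and every vertex of $C(T)$ not in $T$ has no children in $C(T)$ (the completion of the empty tree is a single vertex). If $T$ has $n$ vertices, $C(T)$ has $2n+1$ vertices. The map $\varphi: S_n(132) \to A_{2n+1}(132)$ (defined for every $n \ge 0$): given $w \in S_n(132)$, form $T(w)$, erase its labels, take the completion, take the labeled tree associated to this completion, and let $\varphi(w)$ be the permutation of length $2n+1$ whose image under $T$ is that labeled tree. Equivalently, $\varphi(w)$ is the unique member of $A_{2n+1}(132)$ whose sequence of even-indexed entries is order-isomorphic to $w$. *)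

(* Defs.v *)
From mathcomp Require Import all_boot.

Set Implicit Arguments.
Unset Strict Implicit.
Unset Printing Implicit Defensive.

(* A permutation of length n is a word w : seq nat with                       *)
(* perm_eq w (iota 1 n); sequence positions are 0-based in the code, so the   *)
(* paper's w_1 is nth 0 w 0.                                                  *)

(* w_1 < w_2 > w_3 < ... : the step out of a 0-based position i is an ascent  *)
(* when i is even and a descent when i is odd.                                *)
Definition alternating (w : seq nat) : bool :=
  all (fun i => if odd i then nth 0 w i.+1 < nth 0 w i
                else nth 0 w i < nth 0 w i.+1)
      (iota 0 (size w).-1).

Definition order_iso (u v : seq nat) : bool :=
  (size u == size v) &&
  [forall i : 'I_(size u), forall j : 'I_(size u),
     (nth 0 u i < nth 0 u j) == (nth 0 v i < nth 0 v j)].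

(* The bit vector m selects the positions i_1 < ... < i_m of the occurrence.  *)
Definition contains (w p : seq nat) : bool :=
  [exists m : (size w).-tuple bool, order_iso (mask m w) p].

Definition avoids (w p : seq nat) : bool := ~~ contains w p.

(* S_n(rs) and A_n(rs), as duplicate-free lists.                              *)
Definition Sav (n : nat) (rs : seq (seq nat)) : seq (seq nat) :=
  [seq w <- permutations (iota 1 n) | all (avoids w) rs].

Definition Aav (n : nat) (rs : seq (seq nat)) : seq (seq nat) :=
  [seq w <- Sav n rs | alternating w].

Definition s_ (n : nat) (rs : seq (seq nat)) : nat := size (Sav n rs).
Definition a_ (n : nat) (rs : seq (seq nat)) : nat := size (Aav n rs).

Definition p132 : seq nat := [:: 1; 3; 2].
Definition incr_pat (k : nat) : seq nat := iota 1 k.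

Definition lis (w : seq nat) : nat :=
  \max_(m : (size w).-tuple bool | sorted ltn (mask m w)) size (mask m w).

Inductive tree : Type :=
| Empty
| Node of tree & tree.

Inductive ltree : Type :=
| LEmpty
| LNode of ltree & nat & ltree.

Fixpoint tsize (t : tree) : nat :=
  if t is Node l r then (tsize l + tsize r).+1 else 0.

Fixpoint erase (t : ltree) : tree :=
  if t is LNode l _ r then Node (erase l) (erase r) else Empty.

Fixpoint inorder (t : ltree) : seq nat :=
  if t is LNode l x r then inorder l ++ x :: inorder r else [::].

(* T(w). The first argument of dtree_rec is fuel; size w always suffices.     *)
Fixpoint dtree_rec (fuel : nat) (w : seq nat) : ltree :=
  match fuel, w with
  | f.+1, _ :: _ =>
      let x := \max_(y <- w) y in
      let k := index x w in
      LNode (dtree_rec f (take k w)) x (dtree_rec f (drop k.+1 w))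
  | _, _ => LEmpty
  end.

Definition dtree (w : seq nat) : ltree := dtree_rec (size w) w.

Fixpoint decreasing (t : ltree) : bool :=
  if t is LNode l x r then
    [&& all (fun y => y < x) (inorder l ++ inorder r),
        decreasing l & decreasing r]
  else true.

Fixpoint left_gt_right (t : ltree) : bool :=
  if t is LNode l _ r then
    [&& allrel (fun y z => z < y) (inorder l) (inorder r),
        left_gt_right l & left_gt_right r]
  else true.

Definition is_assoc (t : tree) (t' : ltree) : Prop :=
  [/\ erase t' = t, perm_eq (inorder t') (iota 1 (tsize t)),
      decreasing t' & left_gt_right t'].

(* label_from a t uses the labels a+1, ..., a + tsize t: the largest at the   *)
(* root, the smallest ones in the right subtree.                              *)
Fixpoint label_from (a : nat) (t : tree) : ltree :=
  if t is Node l r then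
    LNode (label_from (a + tsize r) l) (a + tsize t) (label_from a r)
  else LEmpty.

(* The labeled tree associated to t; see assoc_treeP and assoc_tree_unique.   *)
Definition assoc_tree (t : tree) : ltree := label_from 0 t.

Fixpoint completion (t : tree) : tree :=
  if t is Node l r then Node (completion l) (completion r)
  else Node Empty Empty.

(* inorder inverts T; see dtreeK and inorderK.                                *)
Definition phi (w : seq nat) : seq nat :=
  inorder (assoc_tree (completion (erase (dtree w)))).

Lemma mem_bigmax (w : seq nat) : w != [::] -> \max_(y <- w) y \in w.
Proof.
elim: w => // x w IHw _; rewrite big_cons inE.
case: w IHw => [|y w] IHw; first by rewrite big_nil maxn0 eqxx.
by rewrite /maxn; case: ifP => _; rewrite ?eqxx // IHw ?orbT.
Qed.

Lemma dtree_recK f w : size w <= f -> inorder (dtree_rec f w) = w.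
Proof.
elim: f w => [|f IHf] [|x w] // le_wf; rewrite [LHS]/=.
set v := x :: w; set m := \max_(y <- v) y.
have vm : m \in v by exact: mem_bigmax.
have lt_mv : index m v < size v by rewrite index_mem.
rewrite !IHf.
- by rewrite -[RHS](cat_take_drop (index m v)) (drop_nth 0 lt_mv) nth_index.
- by rewrite size_drop /v /=; apply: leq_trans (leq_subr _ _) _.
- by rewrite size_take lt_mv -ltnS; apply: leq_trans lt_mv le_wf.
Qed.

Lemma inorderK w : inorder (dtree w) = w.
Proof. exact: dtree_recK. Qed.

Lemma dtree_rec_inorder f t :
  decreasing t -> size (inorder t) <= f -> dtree_rec f (inorder t) = t.
Proof.
elim: f t => [|f IHf] [|l x r] //=; first by rewrite size_cat addnS.
case/and3P; rewrite all_cat => /andP[lx rx] dl dr.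
rewrite size_cat /= addnS ltnS => szf.
have Emax : \max_(y <- inorder l ++ x :: inorder r) y = x.
  apply/eqP; rewrite eqn_leq; apply/andP; split; last first.
    by rewrite big_cat big_cons /= leq_max leq_max leqnn orbT.
  apply/bigmax_leqP_seq => y + _; rewrite mem_cat inE.
  by case/or3P => [/(allP lx)/ltnW|/eqP->|/(allP rx)/ltnW].
have Eidx : index x (inorder l ++ x :: inorder r) = size (inorder l).
  rewrite index_cat ifN /= ?eqxx ?addn0 //.
  by apply/negP => /(allP lx); rewrite ltnn.
case Ew: (inorder l ++ x :: inorder r) => [|y w].
  by move/(congr1 size): Ew; rewrite size_cat /= addnS.
rewrite -Ew Emax Eidx take_size_cat // -cat_rcons drop_size_cat ?size_rcons //.
rewrite !IHf //; first exact: leq_trans (leq_addl _ _) szf.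
exact: leq_trans (leq_addr _ _) szf.
Qed.

Lemma dtreeK t : decreasing t -> dtree (inorder t) = t.
Proof. by move=> dt; apply: dtree_rec_inorder. Qed.

Lemma erase_label_from a t : erase (label_from a t) = t.
Proof. by elim: t a => //= l IHl r IHr a; rewrite IHl IHr. Qed.

Lemma perm_label_from a t :
  perm_eq (inorder (label_from a t)) (iota a.+1 (tsize t)).
Proof.
elim: t a => // l IHl r IHr a.
rewrite [inorder _]/= [tsize (Node _ _)]/=.
rewrite -cat_rcons perm_catC.
apply: (@perm_trans _
  (iota a.+1 (tsize r) ++ rcons (iota (a + tsize r).+1 (tsize l))
                                (a + (tsize l + tsize r).+1))).
  by apply: perm_cat => //; rewrite perm_rcons perm_sym perm_rcons perm_sym perm_cons.
have -> : (tsize l + tsize r).+1 = tsize r + (tsize l + 1).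
  by rewrite addn1 addnS addnC.
by rewrite !iotaD /= cats1 !addSn addn1 !addnS addnA perm_refl.
Qed.

Lemma mem_label_from a t y :
  y \in inorder (label_from a t) = (a < y <= a + tsize t).
Proof. by rewrite (perm_mem (perm_label_from a t)) mem_iota addSn ltnS. Qed.

Lemma decreasing_label_from a t : decreasing (label_from a t).
Proof.
elim: t a => //= l IHl r IHr a; rewrite IHl IHr !andbT all_cat.
apply/andP; split; apply/allP => y; rewrite mem_label_from => /andP[_ le_y].
  by rewrite addnS ltnS [tsize l + _]addnC addnA.
by rewrite addnS ltnS (leq_trans le_y) // leq_add2l leq_addl.
Qed.

Lemma left_gt_right_label_from a t : left_gt_right (label_from a t).
Proof.
elim: t a => //= l IHl r IHr a; rewrite IHl IHr !andbT.
apply/allrelP => y z; rewrite !mem_label_from => /andP[lt_y _] /andP[_ le_z].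
exact: leq_ltn_trans le_z lt_y.
Qed.

Lemma assoc_treeP t : is_assoc t (assoc_tree t).
Proof.
split; [exact: erase_label_from | exact: perm_label_from |
        exact: decreasing_label_from | exact: left_gt_right_label_from].
Qed.

Lemma size_inorder t : size (inorder t) = tsize (erase t).
Proof.
by elim: t => //= l IHl x r IHr; rewrite size_cat /= IHl IHr addnS.
Qed.

Lemma label_from_unique a t :
  perm_eq (inorder t) (iota a.+1 (tsize (erase t))) ->
  decreasing t -> left_gt_right t -> t = label_from a (erase t).
Proof.
elim: t a => // l IHl x r IHr a.
rewrite [inorder _]/= [tsize (erase (LNode _ _ _))]/= => pw /and3P[ax dl dr] /and3P[lr gl gr].
set sl := sort leq (inorder l); set sr := sort leq (inorder r).
have Es : sr ++ rcons sl x = iota a.+1 (tsize (erase l) + tsize (erase r)).+1.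
  apply: (sorted_eq leq_trans anti_leq); last 1 first.
  - rewrite -(permPr pw) -cat_rcons perm_catC perm_cat ?perm_sort //.
    by rewrite perm_rcons perm_sym perm_rcons perm_sym perm_cons perm_sort.
  - rewrite sorted_pairwise; last exact: leq_trans.
    rewrite pairwise_cat pairwise_rcons.
    rewrite -!(sorted_pairwise leq_trans) !sort_sorted ?andbT; try exact: leq_total.
    rewrite all_cat in ax; case/andP: ax => lx rx.
    apply/andP; split.
      apply/allrelP => y z; rewrite mem_sort mem_rcons inE mem_sort.
      move=> yr /predU1P[->|zl]; first by rewrite ltnW // (allP rx).
      by rewrite ltnW // (allrelP lr).
    by apply/allP => y; rewrite mem_sort => /(allP lx)/ltnW.
  - exact: iota_sorted.
move/eqP: Es.
have -> : (tsize (erase l) + tsize (erase r)).+1 =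
          tsize (erase r) + (tsize (erase l) + 1) by rewrite addn1 addnS addnC.
rewrite !iotaD /= cats1 eqseq_cat; last by rewrite size_sort size_iota size_inorder.
case/andP=> /eqP Er; rewrite eqseq_rcons => /andP[/eqP El /eqP ->].
rewrite -(IHr a) //; last by rewrite -Er perm_sym perm_sort.
rewrite -(IHl (a + tsize (erase r))) //; last by rewrite -addSn -El perm_sym perm_sort.
by rewrite addnS !addSn -addnA [tsize (erase l) + _]addnC.
Qed.

Lemma assoc_tree_unique t t' : is_assoc t t' -> t' = assoc_tree t.
Proof. by case=> <- *; apply: label_from_unique. Qed.

(* Main.v *)
Require Import Defs.
From mathcomp Require Import all_boot zify.

(**
Through [T], the permutations avoiding 132 correspond to the unlabeled binary
trees, and the alternating ones of odd length to the completions. In a word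
[l ++ x :: r] where [x] is the maximum and [l] lies above [r], an increasing
subsequence meeting [l] cannot use [r], so the longest one has length
max (lis l + 1, lis r). Hence lis is the tree statistic with the same recursion,
and completion raises that statistic by one already on the empty tree.
*)

Set Implicit Arguments.
Unset Strict Implicit.
Unset Printing Implicit Defensive.

(** * Pattern containment and [lis] in terms of subsequences *)

Lemma subseq_cat_split (T : eqType) (u v w : seq T) :
  subseq u (v ++ w) ->
  exists u1 u2, [/\ u = u1 ++ u2, subseq u1 v & subseq u2 w].
Proof.
case/subseqP=> m sm ->; exists (mask (take (size v) m) v).
exists (mask (drop (size v) m) w); split; try exact: mask_subseq.
rewrite -{1}(cat_take_drop (size v) m) mask_cat // size_takel // sm size_cat.
exact: leq_addr.
Qed.

(** Trades bit vectors for [subseq], so that an occurrence can be split along a concatenation. *)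
Lemma containsP (w p : seq nat) :
  reflect (exists2 u, subseq u w & order_iso u p) (contains w p).
Proof.
apply: (iffP existsP) => [[m mp]|[u /subseqP[m sm ->] up]].
  by exists (mask m w); rewrite ?mask_subseq.
by exists (tcast sm (in_tuple m)); rewrite val_tcast.
Qed.

Lemma contains_subseq (v w p : seq nat) :
  subseq v w -> contains v p -> contains w p.
Proof.
move=> vw /containsP[u uv up]; apply/containsP; exists u => //.
exact: subseq_trans uv vw.
Qed.

Lemma order_isoP (u v : seq nat) :
  reflect (size u = size v /\ forall i j, i < size u -> j < size u ->
             (nth 0 u i < nth 0 u j) = (nth 0 v i < nth 0 v j))
          (order_iso u v).
Proof.
apply: (iffP andP) => [[/eqP suv /forallP H]|[suv H]]; split=> //.
- move=> i j iu ju; have /forallP/(_ (Ordinal ju))/eqP := H (Ordinal iu).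
  by [].
- exact/eqP.
- by apply/forallP => i; apply/forallP => j; apply/eqP/H.
Qed.

Lemma contains132P (w : seq nat) :
  reflect (exists a b c, subseq [:: a; b; c] w /\ a < c < b)
          (contains w p132).
Proof.
apply: (iffP (containsP _ _)) => [[u uw /order_isoP[]]|[a [b [c [sw /andP[ac cb]]]]]].
  case: u uw => [|a [|b [|c [|]]]] // uw _ H.
  exists a, b, c; split=> //.
  (* Comparing positions 0 and 2, then 2 and 1, already fixes the order of the three entries. *)
  by move: (H 0 2 isT isT) (H 2 1 isT isT) => /= -> ->.
exists [:: a; b; c] => //; apply/order_isoP; split=> // i j.
by case: i => [|[|[|]]] //; case: j => [|[|[|]]] //=; lia.
Qed.

Lemma order_iso_incr (u : seq nat) k :
  order_iso u (incr_pat k) = (size u == k) && sorted ltn u.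
Proof.
apply/order_isoP/andP => [[]|[/eqP su us]]; rewrite /incr_pat size_iota.
  move=> su H; split; first exact/eqP.
  apply/(sortedP 0) => i iu /=; rewrite H ?(ltnW iu) // !nth_iota; lia.
split=> // i j iu ju; rewrite su in iu ju; rewrite !nth_iota // ltn_add2l.
have mono x y : x < y -> x < k -> y < k -> nth 0 u x < nth 0 u y.
  by move=> xy xk yk; apply: (sorted_ltn_nth ltn_trans 0 us); rewrite ?inE ?su.
case: (ltngtP i j) => [ij|ji|->]; last by rewrite ltnn.
  exact: mono.
by apply/negbTE; rewrite -leqNgt ltnW // mono.
Qed.

Lemma leq_lis (w u : seq nat) : subseq u w -> sorted ltn u -> size u <= lis w.
Proof.
case/subseqP=> m sm -> us.
have := @leq_bigmax_cond _ (fun m : (size w).-tuple bool => sorted ltn (mask m w))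
  (fun m => size (mask m w)) (tcast sm (in_tuple m)).
by rewrite val_tcast; apply.
Qed.

Lemma lis_attained (w : seq nat) :
  exists u, [/\ subseq u w, sorted ltn u & size u = lis w].
Proof.
have H : 0 < #|[pred m : (size w).-tuple bool | sorted ltn (mask m w)]|.
  (* The empty subsequence is increasing, so the maximum ranges over a nonempty set and is
     attained. *)
  apply/card_gt0P; exists [tuple of nseq (size w) false].
  by rewrite inE mask_false.
have [m ms Em] := eq_bigmax_cond (fun m : (size w).-tuple bool => size (mask m w)) H.
exists (mask m w); split; rewrite ?mask_subseq //.
Qed.

Lemma contains_incr (w : seq nat) k : contains w (incr_pat k) = (k <= lis w).
Proof.
apply/containsP/idP => [[u uw]|kw].
  by rewrite order_iso_incr => /andP[/eqP <-]; apply: leq_lis.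
have [u [uw us su]] := lis_attained w.
exists (take k u); first exact: subseq_trans (take_subseq _ _) uw.
by rewrite order_iso_incr take_sorted // size_takel ?su ?eqxx.
Qed.

(** * Permutations avoiding 132 as unlabeled trees *)

Lemma avoids132_inorder t :
  decreasing t -> left_gt_right t -> avoids (inorder t) p132.
Proof.
elim: t => [|l IHl x r IHr] /=.
  by move=> _ _; apply/contains132P => -[a [b [c []]]].
rewrite all_cat => /and3P[/andP[/allP lx /allP rx] /IHl al /IHr ar].
case/and3P=> /allrelP lr /al {}al /ar {}ar.
apply/contains132P => -[a [b [c [/subseq_cat_split[u [v [E ul vr]]] /andP[ac cb]]]]].
have vrx y : y \in v -> (y == x) || (y \in inorder r).
  by move/(mem_subseq vr); rewrite inE.
have lu y : y \in u -> y \in inorder l by exact: (mem_subseq ul).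
(* Cases on how many of [a], [b], [c] lie in the left subtree. With none or all three, either
   induction applies or [x] plays the role of [a], impossible as [x] exceeds what follows. With one
   or two, [c] comes after [a] from the left: in the right subtree it would be below [a], and at the
   root it would exceed [b]. *)
case: u ul lu E => [|a' [|b' [|c' [|]]]] // ul lu [].
- move=> /= Ev; move: vr; rewrite -[v]Ev /=; case: eqP => [Ea sr|_ sr].
    have := rx b (mem_subseq (sr : subseq [:: b; c] _) (mem_head _ _)).
    by rewrite -Ea; lia.
  by move/negP: ar; apply; apply/contains132P; exists a, b, c; rewrite ac.
- move=> Ea Ev; have : subseq [:: c] (inorder r).
    by move: vr; rewrite -[v]Ev /=; case: eqP => // _ /cons_subseq.
  by rewrite sub1seq => /(lr a c (lu a _)); rewrite Ea mem_head; lia.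
- move=> Ea Eb Ev; have bx : b < x by apply/lx/lu; rewrite Eb !inE eqxx orbT.
  have al' : a \in inorder l by apply: lu; rewrite Ea mem_head.
  have /vrx/orP[/eqP cx|/(lr a c al')] : c \in v by rewrite -Ev mem_head.
    by lia.
  by lia.
- move=> Ea Eb Ec _; move/negP: al; apply; apply/contains132P.
  by exists a, b, c; rewrite {1}Ea {1}Eb {1}Ec ac.
Qed.

Lemma max_split (w : seq nat) : uniq w -> w != [::] ->
  exists l x r, w = l ++ x :: r /\ all (fun y => y < x) (l ++ r).
Proof.
move=> uw /mem_bigmax; set x := \max_(y <- w) y => xw.
have leqx y : y \in w -> y <= x by move=> yw; apply: leq_bigmax_seq.
move: x xw leqx => x xw leqx; case/splitPr: xw uw leqx => l r uw leqx.
exists l, x, r; split=> //; apply/allP => y yw.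
have /leqx : y \in l ++ x :: r.
  by move: yw; rewrite !mem_cat inE orbCA => ->; rewrite orbT.
rewrite leq_eqVlt => /predU1P[yx|//]; move: yw uw.
by rewrite yx -cat1s uniq_catCA /= => ->.
Qed.

(* An entry before the maximum smaller than one after it would form a 132 with the maximum. *)
Lemma avoids132_tree (w : seq nat) : uniq w -> avoids w p132 ->
  exists t, [/\ inorder t = w, decreasing t & left_gt_right t].
Proof.
have [n] := ubnP (size w); elim: n w => // n IHn w sw uw aw.
have [->|w0] := eqVneq w [::]; first by exists LEmpty.
have [l [x [r [Ew lrx]]]] := max_split uw w0; subst w.
have sub v : subseq v (l ++ x :: r) -> size v < size (l ++ x :: r) ->
    exists t, [/\ inorder t = v, decreasing t & left_gt_right t].
  move=> vw sv; apply: IHn; first exact: leq_trans sv _.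
    exact: subseq_uniq vw uw.
  by apply: contra aw; apply: contains_subseq.
have [|tl [El dl gl]] := sub l (prefix_subseq _ _).
  by rewrite size_cat /=; lia.
have [||tr [Er dr gr]] := sub r.
- by apply: subseq_trans (suffix_subseq _ _); apply: subseq_cons.
- by rewrite size_cat /=; lia.
exists (LNode tl x tr); rewrite /= El Er lrx dl dr gl gr; split=> //; rewrite !andbT.
apply/allrelP => y z yl zr; rewrite ltnNge leq_eqVlt; apply/negP => yz.
move: lrx; rewrite all_cat => /andP[/allP lx /allP rx].
case/predU1P: yz => [yz|yz].
  move: uw; rewrite cat_uniq => /and3P[_ /hasPn/(_ z) + _].
  by rewrite inE zr orbT -yz yl => /(_ isT).
move/negP: aw; apply; apply/contains132P; exists y, x, z.
rewrite yz rx //; split=> //.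
by rewrite -[[:: y; x; z]]/([:: y] ++ [:: x; z]) cat_subseq ?sub1seq //= eqxx sub1seq.
Qed.

(** The shape forces the labels, so statements about these permutations reduce to inductions on
    unlabeled trees. *)
Lemma Sav132P n (w : seq nat) :
  reflect (exists2 t : tree, w = inorder (assoc_tree t) & Defs.tsize t = n)
          (w \in Sav n [:: p132]).
Proof.
rewrite mem_filter mem_permutations /= andbT.
apply: (iffP andP) => [[aw pw]|[t -> <-]]; last first.
  have [_ pt dt gt] := assoc_treeP t; split=> //; exact: avoids132_inorder.
have uw : uniq w by rewrite (perm_uniq pw) iota_uniq.
have [t [Et dt gt]] := avoids132_tree uw aw; subst w.
have st : Defs.tsize (erase t) = n.
  by rewrite -size_inorder (perm_size pw) size_iota.
exists (erase t) => //; congr inorder; apply: assoc_tree_unique.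
by split; rewrite // st.
Qed.

(** * The map [phi] read on shapes *)

Lemma phi_assoc t :
  phi (inorder (assoc_tree t)) = inorder (assoc_tree (completion t)).
Proof.
by rewrite /phi dtreeK ?erase_label_from // decreasing_label_from.
Qed.

Lemma inorder_assoc_inj : injective (inorder \o assoc_tree).
Proof.
move=> t1 t2 /(congr1 (erase \o dtree)) /=.
by rewrite !dtreeK ?decreasing_label_from // !erase_label_from.
Qed.

Lemma completion_inj : injective completion.
Proof.
(* This separates the single vertex completing [Empty] from the completion of a nonempty tree. *)
have ne t : completion t <> Empty by case: t.
elim=> [|l1 IHl r1 IHr] [|l2 r2] //= [].
- by move/esym/ne.
- by move/ne.
- by move=> /IHl -> /IHr ->.
Qed.

Lemma tsize_completion t : Defs.tsize (completion t) = 2 * Defs.tsize t + 1.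
Proof. by elim: t => //= l -> r ->; lia. Qed.

(** * Alternation and completed shapes *)

Lemma alternatingP w :
  reflect (forall i, i.+1 < size w ->
             if odd i then nth 0 w i.+1 < nth 0 w i
             else nth 0 w i < nth 0 w i.+1)
          (alternating w).
Proof.
apply: (iffP allP) => H i; last by rewrite mem_iota => iw; apply: H; lia.
by move=> iw; apply: H; rewrite mem_iota; lia.
Qed.

(** As [l] has odd length, [x] sits at an odd position, a peak, so the steps into and out of it are
    right by maximality. Then [r] starts at an even position and keeps its own parity. *)
Lemma alternating_cat_max l x r :
  all (fun y => y < x) (l ++ r) -> odd (size l) -> odd (size r) ->
  alternating (l ++ x :: r) = alternating l && alternating r.
Proof.
rewrite all_cat => /andP[/(all_nthP 0) lx /(all_nthP 0) rx] ol or_.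
have nthr i : nth 0 (l ++ x :: r) (size l + i).+1 = nth 0 r i.
  by rewrite -addnS nth_cat ltnNge leq_addr addKn.
have nthrS i : nth 0 (l ++ x :: r) (size l + i).+2 = nth 0 r i.+1.
  by rewrite -addnS nthr.
have nthl i : i < size l -> nth 0 (l ++ x :: r) i = nth 0 l i.
  by move=> il; rewrite nth_cat il.
have nthx : nth 0 (l ++ x :: r) (size l) = x.
  by rewrite nth_cat ltnn subnn.
apply/alternatingP/andP => [H|[/alternatingP Hl /alternatingP Hr] i].
  split; apply/alternatingP => i ir.
    by have := H i; rewrite !nthl ?(ltnW ir) // size_cat; apply; lia.
  have := H (size l + i).+1; rewrite /= nthrS nthr oddD ol addTb negbK; apply.
  by rewrite size_cat /=; lia.
rewrite size_cat /= addnS ltnS => isz.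
case: (ltngtP i.+1 (size l)) => [il|li|il].
- by rewrite !nthl ?(ltnW il) //; apply: Hl.
- have [il|il] := eqVneq i (size l).
    by rewrite il ol nthx -[size l]addn0 nthr rx //; lia.
  have -> : i = (size l + (i - (size l).+1)).+1 by lia.
  rewrite nthrS nthr oddS oddD ol addTb negbK; apply: Hr; lia.
- have -> : odd i = false by move: ol; rewrite -il /= => /negbTE.
  by rewrite il nthx nthl -?il // lx -?il.
Qed.

(** Both subtrees of a completed node have odd size, so the maximum is a peak at every level. The
    offset [a] is arbitrary because the labels of a left subtree do not start at 1. *)
Lemma alternating_completion a t :
  alternating (inorder (label_from a (completion t))).
Proof.
elim: t a => // l IHl r IHr a.
have /= := decreasing_label_from a (completion (Node l r)).
case/and3P => lrx _ _; rewrite alternating_cat_max ?IHl ?IHr //.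
all: by rewrite size_inorder erase_label_from tsize_completion oddD oddM.
Qed.

(** Odd total size gives the two subtrees equal parity. Odd ones are completions by induction; even
    ones must be empty, which leaves the single vertex completing [Empty]. *)
Lemma alternating_is_completion t :
  decreasing t -> odd (size (inorder t)) -> alternating (inorder t) ->
  exists t', erase t = completion t'.
Proof.
elim: t => // l IHl x r IHr /= /and3P[lrx dl dr]; rewrite size_cat /= => olr.
have [ol|el] := boolP (odd (size (inorder l))).
  have or_ : odd (size (inorder r)) by lia.
  rewrite alternating_cat_max // => /andP[al ar].
  have [tl ->] := IHl dl ol al; have [tr ->] := IHr dr or_ ar.
  by exists (Node tl tr).
(* An even left part puts the maximum in a valley, so both neighbours must be missing. *)
move/alternatingP => H; exists Empty => /=.
move: lrx; rewrite all_cat => /andP[/(all_nthP 0) lx /(all_nthP 0) rx].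
have nthx : nth 0 (inorder l ++ x :: inorder r) (size (inorder l)) = x.
  by rewrite nth_cat ltnn subnn.
have nthr : nth 0 (inorder l ++ x :: inorder r) (size (inorder l)).+1 =
            nth 0 (inorder r) 0.
  by rewrite -addn1 nth_cat ltnNge leq_addr addKn.
have sr : size (inorder r) = 0.
  apply/eqP; rewrite -leqn0 leqNgt; apply/negP => r0.
  have := H (size (inorder l)); rewrite (negbTE el) nthx nthr size_cat /=; have := rx 0 r0; lia.
have sl : size (inorder l) = 0.
  (* The last entry of a nonempty left part would be at an odd position, where a descent is due, yet
     [x] comes next. *)
  case E: (size (inorder l)) => [//|m].
  have := H m; rewrite -E nthx size_cat nth_cat E ltnSn /=.
  have -> : odd m by lia.
  have := lx m; rewrite E; lia.
rewrite !size_inorder in sl sr.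
by case: (erase l) (erase r) sl sr => [|??] [|??].
Qed.

Lemma phi_Aav n w : w \in Sav n [:: p132] -> phi w \in Aav (2 * n + 1) [:: p132].
Proof.
case/Sav132P => t -> <-; rewrite phi_assoc mem_filter alternating_completion.
by apply/Sav132P; exists (completion t); rewrite ?tsize_completion.
Qed.

Lemma phi_inj n : {in Sav n [:: p132] &, injective phi}.
Proof.
move=> _ _ /Sav132P[t1 -> _] /Sav132P[t2 -> _].
by rewrite !phi_assoc => /inorder_assoc_inj/completion_inj ->.
Qed.

Lemma phi_surj n v : v \in Aav (2 * n + 1) [:: p132] ->
  exists2 w, w \in Sav n [:: p132] & v = phi w.
Proof.
rewrite mem_filter => /andP[av /Sav132P[t Ev st]]; subst v.
have [|t' Et] := alternating_is_completion (decreasing_label_from 0 t) _ av.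
  by rewrite size_inorder erase_label_from st oddD oddM.
rewrite erase_label_from in Et; subst t.
exists (inorder (assoc_tree t')); last by rewrite phi_assoc.
by apply/Sav132P; exists t' => //; move: st; rewrite tsize_completion; lia.
Qed.

(** * Longest increasing subsequences on trees *)

Lemma lis_cat_max l x r :
  all (fun y => y < x) (l ++ r) -> allrel (fun y z => z < y) l r ->
  lis (l ++ x :: r) = maxn (lis l).+1 (lis r).
Proof.
rewrite all_cat => /andP[/allP lx /allP rx] /allrelP lr.
apply/eqP; rewrite eqn_leq; apply/andP; split.
  have [u [/subseq_cat_split[u1 [u2 [-> ul ur]]] us <-]] := lis_attained (l ++ x :: r).
  move: us; rewrite sorted_pairwise; last exact: ltn_trans.
  rewrite pairwise_cat -!(sorted_pairwise ltn_trans) => /and3P[/allrelP u12 s1 s2].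
  have s1l := leq_lis ul s1.
  have [->|[y yu1]] : u1 = [::] \/ exists y, y \in u1.
    by case: (u1) => [|y ?]; [left | right; exists y; apply: mem_head].
  (* Without entries of [l], a subsequence starting with the root entry [x] ends there; any other
     lies in [r]. *)
  - case: u2 ur s2 u12 => [|z u2] //= + s2 _; case: eqP => [Ez u2r|_ ur].
      case: u2 u2r s2 => [|z' u2] u2r /=; first by rewrite leq_max.
      have := rx z' (mem_subseq u2r (mem_head _ _)); rewrite Ez; lia.
    by rewrite leq_max (leq_lis ur) ?orbT.
  (* After an entry [y] of [l], all of [r] is too small, so [u2] contains at most [x], and only
     once. *)
  - have u2x z : z \in u2 -> z = x.
      move=> zu2; have := mem_subseq ur zu2; rewrite inE => /predU1P[//|zr].
      have := lr y z (mem_subseq ul yu1) zr; have := u12 y z yu1 zu2; lia.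
    have : uniq u2 by apply: sorted_uniq s2; [exact: ltn_trans | exact: ltnn].
    move/(@uniq_leq_size _ u2 [:: x]) => su2; rewrite size_cat leq_max.
    by rewrite (leq_trans (leq_add s1l (su2 _))) ?addn1 // => z /u2x ->; rewrite mem_head.
have [u [ul us su]] := lis_attained l; have [v [vr vs sv]] := lis_attained r.
rewrite geq_max; apply/andP; split; last first.
  rewrite -sv; apply: leq_lis vs; apply: subseq_trans vr _.
  exact: subseq_trans (subseq_cons _ x) (suffix_subseq _ _).
rewrite -su -(size_rcons u x); apply: leq_lis.
  by rewrite -cats1 cat_subseq //= eqxx sub0seq.
rewrite sorted_pairwise ?pairwise_rcons; last exact: ltn_trans.
rewrite -(sorted_pairwise ltn_trans) us andbT.
by apply/allP => y /(mem_subseq ul)/lx.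
Qed.

(** The largest number of left steps on a path from the root to an empty subtree. Completion puts a
    vertex at each such end, allowing one more left step. *)
Fixpoint tlis (t : tree) : nat :=
  if t is Node l r then maxn (tlis l).+1 (tlis r) else 0.

Lemma lis_inorder t :
  decreasing t -> left_gt_right t -> lis (inorder t) = tlis (erase t).
Proof.
elim: t => [_ _|l IHl x r IHr /= /and3P[lrx dl dr] /and3P[lr gl gr]].
  by have [u [+ _ <-]] := lis_attained [::]; rewrite subseq0 => /eqP ->.
by rewrite lis_cat_max // IHl // IHr.
Qed.

Lemma tlis_completion t : tlis (completion t) = (tlis t).+1.
Proof. by elim: t => //= l -> r ->; rewrite maxnSS. Qed.

Lemma lis_phi n w : w \in Sav n [:: p132] -> lis (phi w) = (lis w).+1.
Proof.
case/Sav132P => t -> _; rewrite phi_assoc.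
have lisE s : lis (inorder (assoc_tree s)) = tlis s.
  by have [Es _ ds gs] := assoc_treeP s; rewrite lis_inorder ?Es.
by rewrite !lisE tlis_completion.
Qed.

(** * Transfer of the bound on [lis] and the count *)

Lemma mem_Sav_incr n k w :
  (w \in Sav n [:: p132; incr_pat k]) = (w \in Sav n [:: p132]) && (lis w < k).
Proof.
rewrite !mem_filter /= !andbT {2}/avoids contains_incr -ltnNge.
by rewrite andbAC.
Qed.

Theorem corollary4p2 :
  (forall n k : nat, 1 <= k ->
     s_ n [:: p132; incr_pat k] = a_ (2 * n + 1) [:: p132; incr_pat (k + 1)])
  /\
  (forall n k : nat, 1 <= k ->
     forall w : seq nat, w \in Sav n [:: p132] ->
       phi w \in Aav (2 * n + 1) [:: p132] /\
       (lis w = k <-> lis (phi w) = k + 1)).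
Proof.
split=> n k _; last first.
  by move=> w Sw; split; [exact: phi_Aav | rewrite (lis_phi Sw) addn1; split=> [->|[]]].
have AavE v : (v \in Aav (2 * n + 1) [:: p132; incr_pat (k + 1)]) =
              (v \in Aav (2 * n + 1) [:: p132]) && (lis v < k + 1).
  by rewrite [LHS]mem_filter mem_Sav_incr andbA -mem_filter.
have subS w : w \in Sav n [:: p132; incr_pat k] -> w \in Sav n [:: p132].
  by rewrite mem_Sav_incr => /andP[].
(* The sizes agree because [phi] carries the first list, without repetition, onto the members of the
   second: it is bijective and turns [lis w < k] into [lis (phi w) < k + 1]. *)
rewrite /s_ /a_ -(size_map phi); apply/perm_size/uniq_perm.
- rewrite map_inj_in_uniq ?filter_uniq ?permutations_uniq //.
  by move=> w1 w2 /subS Sw1 /subS Sw2; apply: phi_inj Sw1 Sw2.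
- by rewrite !filter_uniq ?permutations_uniq.
move=> v; rewrite AavE; apply/mapP/andP => [[w + ->]|[Av lv]].
  rewrite mem_Sav_incr => /andP[Sw lw].
  by rewrite (phi_Aav Sw) (lis_phi Sw) addn1 ltnS.
have [w Sw Ev] := phi_surj Av; exists w => //.
by rewrite mem_Sav_incr Sw; move: lv; rewrite Ev (lis_phi Sw) addn1 ltnS.
Qed.
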